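(* Let us assume that the sequences $\{s_n\}$ and $\{\omega_n\}$ satisfy the following: (S-0) the elements of $\{s_n\}$ are the partial sums of an infinite series which either converges to some limit $s$ or in the case of divergence can be summed to give $s$; (S-1) the elements of the sequence $\{\omega_n\}$ of (nonzero) remainder estimates for $\{s_n\}$ are strictly alternating in sign; (S-2) for all $n\in\mathbb N_0$ the ratio $(s_n-s)/\omega_n$ can be expressed as a factorial series $$\frac{s_n-s}{\omega_n}=\sum_{j=0}^{\infty}\frac{c_j}{(\beta+n)_j},\qquad \beta\in\mathbb R,\ \beta>0,\quad n\in\mathbb N_0.$$ Let the sequence transformation $\mathcal S_k^{(n)}(\beta,s_n,\omega_n)$ be used for the transformation of $\{s_n\}$. Then for fixed $k\in\mathbb N$ and for all $n\in\mathbb N_0$ $$\left|\mathcal S_k^{(n)}(\beta,s_n,\omega_n)-s\right|\le\left|\frac{\omega_n}{(\beta+n)_{2k}}\sum_{j=0}^{\infty}\frac{c_{k+j}\,(j+1)_k}{(\beta+n+2k)_j}\right| .$$ This implies for fixed $k\in\mathbb N$ and for large values of $n$ the order estimate $$\frac{\mathcal S_k^{(n)}(\beta,s_n,\omega_n)-s}{s_n-s}=O(n^{-2k}),\qquad n\to\infty.$$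
   Context: $(a)_m=a(a+1)\cdots(a+m-1)$, $(a)_0=1$, is the Pochhammer symbol. The forward difference operator is $\Delta f(n)=f(n+1)-f(n)$ and acts on $n$ only. The sequence transformation is $$\mathcal S_k^{(n)}(\beta,s_n,\omega_n)=\frac{\Delta^k\{(\beta+n)_{k-1}\,s_n/\omega_n\}}{\Delta^k\{(\beta+n)_{k-1}/\omega_n\}}=\frac{\sum_{j=0}^k(-1)^j\binom kj\frac{(\beta+n+j)_{k-1}}{(\beta+n+k)_{k-1}}\frac{s_{n+j}}{\omega_{n+j}}}{\sum_{j=0}^k(-1)^j\binom kj\frac{(\beta+n+j)_{k-1}}{(\beta+n+k)_{k-1}}\frac{1}{\omega_{n+j}}}.$$ In the divergent case $s$ is called the antilimit of the sequence.
   Formalization: The order estimate is stated only for c_0 ≠ 0; without this it fails, e.g. β=1, ω_n=(-1)^n, s_n=s+(-1)^n/(n+1), k=1 gives ratio 1/(2(n+2)). The inequality is stated without this assumption. *)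

(* Defs.v *)
From HB Require Import structures.
From mathcomp Require Export all_boot all_order all_algebra.
From mathcomp Require Export all_classical all_reals all_analysis.
Export Order.TTheory GRing.Theory Num.Theory.
Export numFieldNormedType.Exports.

Set Implicit Arguments.
Unset Strict Implicit.
Unset Printing Implicit Defensive.

Local Open Scope ring_scope.
Local Open Scope classical_set_scope.

Section Definitions.
Variable R : realType.
Implicit Types (u w : nat -> R) (k n : nat).

Definition poch (a : R) (m : nat) : R := \prod_(i < m) (a + i%:R).

Definition fdiff (f : nat -> R) : nat -> R := fun n => f n.+1 - f n.

(* Only meaningful for 0 < k, because of the index k - 1. *)
Definition wenigerS_num (beta : R) u w k n : R :=
  iter k fdiff (fun m => poch (beta + m%:R) k.-1 * u m / w m) n.

Definition wenigerS_den (beta : R) w k n : R :=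
  iter k fdiff (fun m => poch (beta + m%:R) k.-1 / w m) n.

Definition wenigerS (beta : R) u w k n : R :=
  wenigerS_num beta u w k n / wenigerS_den beta w k n.

(* [summ a s] reads "the method summ assigns the value s to the series with
   terms a"; the summation method is not specified any further, so that s is
   the limit of the partial sums or, if they diverge, their antilimit. *)
Definition limit_or_antilimit (summ : (nat -> R) -> R -> Prop)
    (a : nat -> R) (s : R) : Prop :=
  (series a @ \oo --> s) \/ (~ cvgn (series a) /\ summ a s).

Definition strictly_alternating w : Prop :=
  forall n, w n != 0 /\ Num.sg (w n.+1) = - Num.sg (w n).

Definition has_factorial_series (c : nat -> R) (z v : R) : Prop :=
  series (fun j => c j / poch z j) @ \oo --> v.

Lemma iter_fdiffE k (f : nat -> R) n :
  iter k fdiff f n =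
  (-1) ^+ k * \sum_(j < k.+1) (-1) ^+ j * 'C(k, j)%:R * f (n + j)%N.
Proof.
elim: k n => [|k IH] n.
  by rewrite big_ord_recr big_ord0 /= !expr0 bin0 add0r !mul1r addn0.
rewrite iterS {1}/fdiff !IH exprS -mulrBr -mulrA mulN1r -mulrN; congr (_ * _).
rewrite [in RHS]big_ord_recl /= [X in _ - X]big_ord_recl /= !bin0 !addn0.
under [in RHS]eq_bigr => j _ do
  rewrite /bump /= add1n binS natrD mulrDr mulrDl exprS addnS.
rewrite big_split /= [X in _ = - (_ + (X + _))]big_ord_recr /=.
rewrite bin_small // mulr0 mul0r addr0.
under [X in _ - (_ + X)]eq_bigr => j _ do rewrite /bump /= add1n exprS addnS.
rewrite [X in _ = - (_ + (_ + X))](_ : _ =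
  - \sum_(j < k.+1) (-1) ^+ j * 'C(k, j)%:R * f (n.+1 + j)%N); last first.
  rewrite -sumrN; apply: eq_bigr => j _.
  by rewrite addSn mulN1r !mulNr.
by rewrite addrA opprB opprD.
Qed.

(* The explicit quotient of finite sums for the transformation. *)
Lemma wenigerSE (beta : R) u w k n : 0 < beta ->
  wenigerS beta u w k n =
  (\sum_(j < k.+1) (-1) ^+ j * 'C(k, j)%:R
     * (poch (beta + n%:R + j%:R) k.-1 / poch (beta + n%:R + k%:R) k.-1)
     * (u (n + j)%N / w (n + j)%N)) /
  (\sum_(j < k.+1) (-1) ^+ j * 'C(k, j)%:R
     * (poch (beta + n%:R + j%:R) k.-1 / poch (beta + n%:R + k%:R) k.-1)
     * (1 / w (n + j)%N)).
Proof.
move=> b0; set p := poch (beta + n%:R + k%:R) k.-1.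
have p0 : p != 0.
  apply/prodf_neq0 => i _; apply: lt0r_neq0.
  by rewrite ltr_wpDr// ltr_wpDr// ltr_wpDr.
rewrite /wenigerS /wenigerS_num /wenigerS_den !iter_fdiffE.
rewrite -mulf_div divff ?mul1r; last by rewrite signr_eq0.
have E (x : nat -> R) : \sum_(j < k.+1) (-1) ^+ j * 'C(k, j)%:R
     * (poch (beta + n%:R + j%:R) k.-1 / p) * x j =
   p^-1 * \sum_(j < k.+1) (-1) ^+ j * 'C(k, j)%:R
     * (poch (beta + (n + j)%:R) k.-1 * x j).
  rewrite mulr_sumr; apply: eq_bigr => j _.
  rewrite natrD addrA -!mulrA [RHS]mulrCA; congr (_ * _).
  by rewrite [RHS]mulrCA [in RHS](mulrCA p^-1).
rewrite (E (fun j => u (n + j)%N / w (n + j)%N)) (E (fun j => 1 / w (n + j)%N)).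
rewrite -mulf_div divff ?invr_eq0// mul1r.
by congr (_ / _); apply: eq_bigr => j _; rewrite ?div1r ?mulrA.
Qed.

End Definitions.

(* Main.v *)
(* The numerator of S_k^(n) - s is Delta^k applied to the series of terms
   c_j (beta + n)_(k-1) / (beta + n)_j. For j < k these are polynomials in n of
   degree < k and are annihilated; for j >= k they are 1 / (beta + n + k - 1)_m
   with m = j - k + 1, whose k-th difference is explicit. The denominator is a
   sum of terms of equal sign, so it dominates its first one; this gives the
   bound. For the order estimate, Abel summation bounds a factorial series
   uniformly to the right of a point of convergence; applied to the series in
   the bound, and to the given one with c_0 removed and 1 / (beta + n) factored
   out, it shows that the former is O(1) and that (s_n - s) / w_n tends
   to c_0. *)
Require Import Defs.
From mathcomp Require Import ring lra zify.

Local Open Scope ring_scope.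
Local Open Scope classical_set_scope.

Set Implicit Arguments.
Unset Strict Implicit.
Unset Printing Implicit Defensive.

(** * Pochhammer symbols: splitting, positivity, comparison with powers *)

Section Pochhammer.
Variable R : realType.
Implicit Types (a x z : R) (m n : nat).

Lemma poch0 a : poch a 0 = 1.
Proof. by rewrite /poch big_ord0. Qed.

Lemma pochS a m : poch a m.+1 = poch a m * (a + m%:R).
Proof. by rewrite /poch big_ord_recr. Qed.

Lemma pochSl a m : poch a m.+1 = a * poch (a + 1) m.
Proof.
rewrite /poch big_ord_recl addr0; congr (_ * _).
by apply: eq_bigr => i _; rewrite /= /bump /= natrD addrA.
Qed.

Lemma pochD a m n : poch a (m + n) = poch a m * poch (a + m%:R) n.
Proof.
elim: n => [|n IH]; first by rewrite addn0 poch0 mulr1.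
by rewrite addnS !pochS IH natrD addrA mulrA.
Qed.

Lemma poch_gt0 a m : 0 < a -> 0 < poch a m.
Proof. by move=> a0; apply: prodr_gt0 => i _; rewrite ltr_wpDr. Qed.

Lemma poch_neq0 a m : 0 < a -> poch a m != 0.
Proof. by move=> /(poch_gt0 m) /lt0r_neq0. Qed.

(** Every factor is at least [x]. This later trades the Pochhammer symbol of the error bound for a
    power of [n]. *)
Lemma exprn_le_poch a m x : 0 <= x -> x <= a -> x ^+ m <= poch a m.
Proof.
move=> x0 xa; elim: m => [|m IH]; first by rewrite expr0 poch0.
rewrite exprSr pochS ler_pM ?exprn_ge0//.
by rewrite (le_trans xa)// lerDl.
Qed.

End Pochhammer.

(** * Iterated differences of Pochhammer symbols and of their reciprocals *)

Section Differences.
Variable R : realType.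
Implicit Types (f g : nat -> R) (a b : R) (k m n : nat).

Lemma iter_fdiffB k f g n :
  iter k (@fdiff R) (fun m => f m - g m) n =
  iter k (@fdiff R) f n - iter k (@fdiff R) g n.
Proof. by elim: k n => [//|k IH] n; rewrite !iterS /fdiff !IH; ring. Qed.

Lemma iter_fdiffZ k a f n :
  iter k (@fdiff R) (fun m => a * f m) n = a * iter k (@fdiff R) f n.
Proof. by elim: k n => [//|k IH] n; rewrite !iterS /fdiff !IH mulrBr. Qed.

Lemma iter_fdiff_sum k (F : nat -> nat -> R) p q n :
  iter k (@fdiff R) (fun m => \sum_(p <= j < q) F j m) n =
  \sum_(p <= j < q) iter k (@fdiff R) (F j) n.
Proof. by elim: k n => [//|k IH] n; rewrite iterS /fdiff !IH -sumrB. Qed.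

Lemma eq_iter_fdiff k f g n :
  f =1 g -> iter k (@fdiff R) f n = iter k (@fdiff R) g n.
Proof. by move=> fg; elim: k n => [//|k IH] n; rewrite !iterS /fdiff !IH. Qed.

Lemma cvg_iter_fdiff k (F : nat -> nat -> R) f n :
  (forall m, F ^~ m @ \oo --> f m) ->
  (fun j => iter k (@fdiff R) (F j) n) @ \oo --> iter k (@fdiff R) f n.
Proof.
move=> Ff; elim: k n => [|k IH] n; first exact: Ff.
by rewrite iterS /fdiff; apply: cvgB; apply: IH.
Qed.

(** One difference turns [(a+i)_m] into [m (a+1+i)_(m-1)], so the degree drops each time; the
    induction keeps [a] general because the base moves. *)
Lemma iter_fdiff_poch k a m n : (m < k)%N ->
  iter k (@fdiff R) (fun i => poch (a + i%:R) m) n = 0.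
Proof.
elim: k a m n => [//|k IH] a [|m] n mk; rewrite iterSr.
  rewrite (@eq_iter_fdiff _ _ (fun i => 0 * i%:R)) ?iter_fdiffZ ?mul0r// => i.
  by rewrite /fdiff !poch0 subrr mul0r.
rewrite (@eq_iter_fdiff _ _
  (fun i => m.+1%:R * poch (a + 1 + i%:R) m)); last first.
  move=> i; rewrite /fdiff -natr1 addrA [a + 1 + _]addrAC.
  by rewrite pochS [poch (a + _) _]pochSl -[m.+1%:R]natr1; ring.
by rewrite iter_fdiffZ IH ?mulr0.
Qed.

(** Induction on [k] from [1/(x+1)_p - 1/(x)_p = -p/(x)_(p+1)] with [p = m + k]; the factors [p]
    collect into [poch m%:R k]. *)
Lemma iter_fdiff_poch_inv k a m n : 0 < a ->
  iter k (@fdiff R) (fun i => (poch (a + i%:R) m)^-1) n =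
  (-1) ^+ k * poch m%:R k / poch (a + n%:R) (m + k).
Proof.
move=> a0; elim: k n => [|k IH] n; first by rewrite poch0 addn0 !mul1r.
rewrite iterS /fdiff !IH addnS -natr1 addrA.
have x0 : 0 < a + n%:R by rewrite ltr_wpDr.
set x := a + n%:R in x0 *.
(* Both sides are [poch x (m + k).+1], with the last or the first factor split off. *)
have E : (x + (m + k)%:R) * poch x (m + k) = x * poch (x + 1) (m + k).
  by rewrite mulrC -pochS pochSl.
have p0 := poch_neq0 (m + k) x0.
have p1 : poch (x + 1) (m + k) != 0 by rewrite poch_neq0// addr_gt0.
have y0 : x + (m + k)%:R != 0 by rewrite lt0r_neq0// ltr_wpDr.
rewrite !pochS exprS.
have -> : poch x (m + k) = x * poch (x + 1) (m + k) / (x + (m + k)%:R).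
  by rewrite -E mulrAC mulfV ?mul1r.
rewrite natrD in y0 *; field.
by rewrite y0 p1 lt0r_neq0.
Qed.

End Differences.

(** * Factorial series: termwise differences, uniform bounds, limit *)

Section FactorialSeries.
Variable R : realType.
Implicit Types (c d f : nat -> R) (a b z : R) (k m n : nat).

Lemma cvg_series_shift d N a : (forall j, (j < N)%N -> d j = 0) ->
  series d @ \oo --> a -> series (fun j => d (N + j)%N) @ \oo --> a.
Proof.
move=> d0; rewrite -(cvg_shiftn N).
apply: cvg_trans; apply: near_eq_cvg; near=> j => /=.
rewrite /series /= (@big_cat_nat _ _ _ N 0) ?leq_addl//=.
rewrite big1_seq ?add0r; last first.
  by move=> i; rewrite mem_index_iota => /andP[_ /andP[_ /d0]].
rewrite -{1}[N]add0n big_addn addnK.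
by apply: eq_bigr => i _; rewrite addnC.
Unshelve. all: by end_near. Qed.

(** Cancelling the first [k] factors leaves the reciprocal of [(b+k+m)_(i+1)]. Here [k] is the order
    minus one, which avoids [k.-1]. *)
Lemma iter_fdiff_factorial_term b k i n : 0 < b ->
  iter k.+1 (@fdiff R)
    (fun m => poch (b + m%:R) k / poch (b + m%:R) (k.+1 + i)) n =
  (-1) ^+ k.+1 / poch (b + n%:R + k%:R) k.+2 *
    (poch i.+1%:R k.+1 / poch (b + n%:R + (2 * k.+1)%:R) i).
Proof.
move=> b0.
have x0 m : 0 < b + m%:R by rewrite ltr_wpDr.
rewrite (@eq_iter_fdiff _ _ _ (fun m => (poch (b + k%:R + m%:R) i.+1)^-1)).
  rewrite iter_fdiff_poch_inv// addrAC.
  rewrite (_ : (i.+1 + k.+1)%N = (k.+2 + i)%N); last by lia.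
  rewrite pochD.
  rewrite (_ : b + n%:R + k%:R + k.+2%:R = b + n%:R + (2 * k.+1)%:R).
    by rewrite invfM !mulrA; congr (_ * _); rewrite mulrAC.
  by rewrite -addrA -natrD; congr (_ + _%:R); lia.
move=> m; rewrite addSnnS pochD invfM mulrA mulfV ?mul1r ?poch_neq0//.
by rewrite addrAC.
Qed.

(** A difference of fixed order involves finitely many values, so it commutes with the limit of the
    partial sums. This gives both the convergence of the series in the error bound and its value. *)
Lemma cvg_iter_fdiff_factorial_series c f b k n : 0 < b ->
  (forall m, has_factorial_series c (b + m%:R) (f m)) ->
  series (fun j => c (k.+1 + j)%N * poch j.+1%:R k.+1
            / poch (b + n%:R + (2 * k.+1)%:R) j) @ \oo -->
  (-1) ^+ k.+1 * poch (b + n%:R + k%:R) k.+2 *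
    iter k.+1 (@fdiff R) (fun m => poch (b + m%:R) k * f m) n.
Proof.
move=> b0 hf.
have x0 m : 0 < b + m%:R by rewrite ltr_wpDr.
set t := fun j m => c j * (poch (b + m%:R) k / poch (b + m%:R) j).
have ct m : series (t ^~ m) @ \oo --> poch (b + m%:R) k * f m.
  have -> : series (t ^~ m) =
     (fun J => poch (b + m%:R) k * series (fun j => c j / poch (b + m%:R) j) J).
    apply/funext => J; rewrite /series /= mulr_sumr; apply: eq_bigr => j _.
    by rewrite /t; ring.
  by apply: cvgMl_tmp; apply: hf.
have := @cvg_iter_fdiff _ k.+1 (fun J m => series (t ^~ m) J) _ n ct.
under eq_fun do rewrite iter_fdiff_sum.
move=> cD; set P := poch _ k.+2.
have P0 : P != 0 by rewrite poch_neq0// ltr_wpDr.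
(* For [j <= k] the quotient is the polynomial [(b+j+m)_(k-j)], of degree below the order [k.+1]. *)
have d0 : forall j, (j < k.+1)%N -> iter k.+1 (@fdiff R) (t j) n = 0.
  move=> j jk; rewrite iter_fdiffZ (@eq_iter_fdiff _ _ _
    (fun m => poch (b + j%:R + m%:R) (k - j))).
    by rewrite iter_fdiff_poch ?mulr0// ltnS leq_subr.
  move=> m; rewrite -{1}(subnKC (jk : (j <= k)%N)) pochD mulrAC mulfV ?poch_neq0//.
  by rewrite mul1r addrAC.
apply: cvg_trans (cvgMl_tmp (a := (-1) ^+ k.+1 * P) (cvg_series_shift d0 cD)).
apply: near_eq_cvg; near=> J.
rewrite /series mulr_sumr; apply: eq_bigr => i _.
rewrite iter_fdiffZ iter_fdiff_factorial_term// -/P.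
rewrite -[RHS]mulrA [LHS]mulrCA; congr (_ * _).
by rewrite [LHS]mulrA [X in X * _]mulrACA divff// mulr1 -expr2 sqrr_sign mul1r.
Unshelve. all: by end_near. Qed.

(** Summation by parts: the weights [u m] and [u j - u j.+1] are nonnegative and add up to [u 0]. *)
Lemma abel_bound d (u : nat -> R) M m :
  (forall n, `|series d n| <= M) -> (forall j, 0 <= u j) ->
  (forall j, u j.+1 <= u j) ->
  `|\sum_(0 <= j < m) d j * u j| <= M * u 0%N.
Proof.
move=> dM u0 udec.
have -> : \sum_(0 <= j < m) d j * u j =
    series d m * u m + \sum_(0 <= j < m) series d j.+1 * (u j - u j.+1).
  elim: m => [|m IH]; first by rewrite /series /= !big_geq// mul0r addr0.
  rewrite !big_nat_recr//= IH.
  have -> : series d m = series d m.+1 - d m by rewrite -(seriesSB d); ring.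
  ring.
apply: le_trans (ler_normD _ _) _.
have -> : M * u 0%N = M * u m + \sum_(0 <= j < m) M * (u j - u j.+1).
  rewrite -mulr_sumr.
  have -> : \sum_(0 <= j < m) (u j - u j.+1) = - (u m - u 0%N).
    rewrite -telescope_sumr// -sumrN.
    by apply: eq_bigr => i _; rewrite opprB.
  by ring.
apply: lerD; first by rewrite normrM (ger0_norm (u0 m)) ler_wpM2r.
apply: le_trans (ler_norm_sum _ _ _) _; apply: ler_sum => j _.
by rewrite normrM (ger0_norm (_ : 0 <= u j - u j.+1)) ?subr_ge0// ler_wpM2r// subr_ge0.
Qed.

(* The terms at [z] are those at [z0] times (z0)_j/(z)_j, which decreases in j. *)
Lemma factorial_series_bounded d z0 : 0 < z0 ->
  cvgn (series (fun j => d j / poch z0 j)) ->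
  exists M : R, forall z v, z0 <= z -> has_factorial_series d z v -> `|v| <= M.
Proof.
move=> z00 /cvg_seq_bounded/ex_bound[|M bM].
  exact: (globally_properfilter (a := 0%N)).
exists M => z v zz hv.
have pz m : 0 < poch z m by rewrite poch_gt0// (lt_le_trans z00).
have pz0 m : 0 < poch z0 m by rewrite poch_gt0.
have /cvg_norm cv := hv.
rewrite -(cvg_lim _ cv)//; apply: limr_le; first by apply: cvgP; exact: cv.
apply: nearW => m /=.
rewrite (_ : series _ m = \sum_(0 <= j < m)
    (d j / poch z0 j) * (poch z0 j / poch z j)); last first.
  by apply: eq_bigr => j _; rewrite mulrA divfK ?lt0r_neq0.
have := @abel_bound (fun j => d j / poch z0 j) (fun j => poch z0 j / poch z j) M m.
rewrite !poch0 divr1 mulr1; apply.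
- by move=> n; apply: bM.
- by move=> j; rewrite divr_ge0// ltW.
move=> j; rewrite !pochS invfM mulrACA ler_piMr ?divr_ge0 ?(ltW (pz _)) ?(ltW (pz0 _))//.
by rewrite ler_pdivrMr ?mul1r ?lerD2r// ltr_wpDr// (lt_le_trans z00).
Qed.

(** Since [(z)_(j+1) = z (z+1)_j], every term after the first carries a factor [1/z]. *)
Lemma factorial_series_shift c z v : 0 < z -> has_factorial_series c z v ->
  has_factorial_series (fun j => c j.+1) (z + 1) (z * (v - c 0%N)).
Proof.
move=> z0; rewrite /has_factorial_series -(cvg_shiftn 1) => cv.
apply: cvg_trans (cvgMl_tmp (a := z) (cvgB cv (cvg_cst (c 0%N)))).
apply: near_eq_cvg; near=> J => /=.
transitivity (z * (series (fun j => c j / poch z j) J.+1 - c 0%N)).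
  by rewrite -[in RHS]addn1.
rewrite /series /= big_nat_recl//= poch0 divr1 addrAC subrr add0r mulr_sumr.
by apply: eq_bigr => j _; rewrite pochSl invfM mulrCA mulVKf ?lt0r_neq0.
Unshelve. all: by end_near. Qed.

(** The shifted series are taken at points to the right of [b + 1], so a single [M] bounds them
    all. *)
Lemma factorial_series_limit c f b : 0 < b ->
  (forall n, has_factorial_series c (b + n%:R) (f n)) ->
  exists M : R, forall n, `|f n - c 0%N| <= M / (b + n%:R).
Proof.
move=> b0 hf.
have x0 n : 0 < b + n%:R by rewrite ltr_wpDr.
have hs n := factorial_series_shift (x0 n) (hf n).
have [||M hM] := @factorial_series_bounded (fun j => c j.+1) (b + 0%:R + 1).
- by rewrite ltr_wpDr.
- by apply: cvgP; exact: (hs 0).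
exists M => n; rewrite ler_pdivlMr// mulrC -[X in X * _]gtr0_norm// -normrM.
by apply: hM (hs n); rewrite lerD2r lerD2l ler_nat.
Qed.

End FactorialSeries.

(** * The transformation: size of the denominator and error bound *)

Section Weniger.
Variable R : realType.
Implicit Types (u w : nat -> R) (b s : R) (k n : nat).

Lemma sgr_alternating w n j :
  strictly_alternating w -> Num.sg (w (n + j)%N) = (-1) ^+ j * Num.sg (w n).
Proof.
move=> wA; elim: j => [|j IH]; first by rewrite addn0 expr0 mul1r.
by rewrite addnS (wA _).2 IH exprS mulN1r mulNr.
Qed.

(* The alternating signs of the weights and of the difference operator cancel,
   so all terms have the same sign and the one with j = 0 is a lower bound. *)
Lemma wenigerS_den_ge b w k n : 0 < b -> strictly_alternating w ->
  poch (b + n%:R) k.-1 / `|w n| <= `|wenigerS_den b w k n|.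
Proof.
move=> b0 wA; rewrite /wenigerS_den iter_fdiffE.
have x0 m : 0 < b + m%:R by rewrite ltr_wpDr.
have -> : \sum_(j < k.+1) (-1) ^+ j * 'C(k, j)%:R *
      (poch (b + (n + j)%:R) k.-1 / w (n + j)%N) =
    Num.sg (w n) * \sum_(j < k.+1) 'C(k, j)%:R *
      (poch (b + (n + j)%:R) k.-1 / `|w (n + j)%N|).
  rewrite mulr_sumr; apply: eq_bigr => j _.
  have -> : (w (n + j)%N)^-1 = (-1) ^+ j * Num.sg (w n) / `|w (n + j)%N|.
    by rewrite -sgr_alternating// {1}[w (n + j)%N]numEsg invfM invr_sg.
  rewrite [LHS](_ : _ = ((-1) ^+ j * (-1) ^+ j) * (Num.sg (w n) *
    ('C(k, j)%:R * (poch (b + (n + j)%:R) k.-1 / `|w (n + j)%N|)))); last by ring.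
  by rewrite -expr2 sqrr_sign mul1r.
rewrite !normrM normr_sign normr_sg (wA n).1 !mul1r.
rewrite ger0_norm; last first.
  by apply: sumr_ge0 => j _; rewrite mulr_ge0// divr_ge0// ltW// poch_gt0.
rewrite big_ord_recl /= bin0 mul1r addn0 lerDl.
by apply: sumr_ge0 => j _; rewrite mulr_ge0// divr_ge0// ltW// poch_gt0.
Qed.

(** For fixed [w] the transformation is linear in [u] and fixes constants, so [s] can be subtracted
    inside the difference. *)
Lemma wenigerS_subE b u w s k n : wenigerS_den b w k n != 0 ->
  wenigerS b u w k n - s =
  iter k (@fdiff R) (fun m => poch (b + m%:R) k.-1 * ((u m - s) / w m)) n
    / wenigerS_den b w k n.
Proof.
move=> d0; rewrite /wenigerS -{1}[s](mulfK d0) -mulrBl; congr (_ / _).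
rewrite /wenigerS_num /wenigerS_den -iter_fdiffZ -iter_fdiffB.
by apply: eq_iter_fdiff => m; ring.
Qed.

Lemma wenigerS_den_neq0 b w k n : 0 < b -> strictly_alternating w ->
  wenigerS_den b w k n != 0.
Proof.
move=> b0 wA; rewrite -normr_gt0; apply: lt_le_trans (wenigerS_den_ge k n b0 wA).
by rewrite divr_gt0 ?poch_gt0 ?normr_gt0 ?(wA n).1// ltr_wpDr.
Qed.

Lemma wenigerS_error_bound b u w s c k n : 0 < b -> strictly_alternating w ->
  (forall m, has_factorial_series c (b + m%:R) ((u m - s) / w m)) ->
  `|wenigerS b u w k.+1 n - s| <=
  `|w n / poch (b + n%:R) (2 * k.+1)
    * limn (series (fun j => c (k.+1 + j)%N * poch j.+1%:R k.+1
        / poch (b + n%:R + (2 * k.+1)%:R) j))|.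
Proof.
move=> b0 wA hf.
rewrite (cvg_lim _ (@cvg_iter_fdiff_factorial_series _ _ _ _ k n b0 hf))//.
have d0 := wenigerS_den_neq0 k.+1 n b0 wA.
have x0 : 0 < b + n%:R by rewrite ltr_wpDr.
rewrite wenigerS_subE//=.
set D := fdiff _ _.
(* The first [k] factors match the lower bound of the denominator; the other [k.+2] cancel against
   the value of the series. *)
rewrite (_ : (2 * k.+1)%N = (k + k.+2)%N); last by lia.
rewrite pochD.
have P0 : 0 < poch (b + n%:R) k by rewrite poch_gt0.
have Q0 : 0 < poch (b + n%:R + k%:R) k.+2 by rewrite poch_gt0// ltr_wpDr.
rewrite (_ : w n / _ * _ =
    (-1) ^+ k.+1 * (D * (poch (b + n%:R) k / w n)^-1)); last first.
  by field; rewrite (wA n).1 !lt0r_neq0.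
rewrite [leRHS]normrM normr_sign mul1r !normrM.
rewrite ler_wpM2l// !normfV lef_pV2 ?posrE ?normr_gt0//; last first.
  by rewrite mulf_neq0 ?invr_eq0 ?(wA n).1// lt0r_neq0.
by rewrite normrM normfV (gtr0_norm P0) (wenigerS_den_ge k.+1).
Qed.

End Weniger.

Theorem mainTheorem3 (R : realType)
  (summ : (nat -> R) -> R -> Prop)
  (a s_ w c : nat -> R) (s beta : R)
  (s_partial_sums : forall n : nat, s_ n = \sum_(0 <= j < n.+1) a j)
  (S0 : limit_or_antilimit summ a s)
  (S1 : strictly_alternating w)
  (beta_gt0 : 0 < beta)
  (S2 : forall n : nat,
    has_factorial_series c (beta + n%:R) ((s_ n - s) / w n))
  (k : nat) (k_gt0 : (0 < k)%N) :
  (forall n : nat,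
    [/\ wenigerS_den beta w k n != 0,
        cvgn (series (fun j : nat =>
          c (k + j)%N * poch (j.+1)%:R k
            / poch (beta + n%:R + (2 * k)%:R) j)) &
        `|wenigerS beta s_ w k n - s| <=
        `|w n / poch (beta + n%:R) (2 * k)
          * limn (series (fun j : nat =>
              c (k + j)%N * poch (j.+1)%:R k
                / poch (beta + n%:R + (2 * k)%:R) j))| ])
  /\
  (c 0%N != 0 ->
    (\forall n \near \oo, s_ n != s) /\
    (fun n : nat => (wenigerS beta s_ w k n - s) / (s_ n - s) : R^o)
      =O_\oo (fun n : nat => n%:R ^- (2 * k) : R^o)).
Proof.
case: k k_gt0 => // k _.
have cvS n := @cvg_iter_fdiff_factorial_series _ _ _ _ k n beta_gt0 S2.
have bd n := wenigerS_error_bound k n beta_gt0 S1 S2.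
split=> [n|c0].
  split; [exact: wenigerS_den_neq0 | by apply: cvgP; exact: cvS | exact: bd].
have x0 n : 0 < beta + n%:R by rewrite ltr_wpDr.
have [M hM] := factorial_series_limit beta_gt0 S2.
(* The point for [n = 0] is the leftmost, so [M'] serves for all [n]. *)
have [||M' hM'] := @factorial_series_bounded _
    (fun j => c (k.+1 + j)%N * poch j.+1%:R k.+1) (beta + 0%:R + (2 * k.+1)%:R).
- by rewrite ltr_wpDr.
- by apply: cvgP; exact: (cvS 0%N).
have half : \forall n \near \oo, `|c 0%N| / 2 <= `|(s_ n - s) / w n|.
  near=> n.
  have H : M / (beta + n%:R) <= `|c 0%N| / 2.
    rewrite ler_pdivrMr// -ler_pdivrMl ?divr_gt0 ?normr_gt0//.
    apply: (@le_trans _ _ n%:R); last by rewrite lerDr ltW.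
    by near: n; exact: nbhs_infty_ger.
  have := ler_distD ((s_ n - s) / w n) (c 0%N) 0; rewrite !subr0 distrC.
  by have := hM n; lra.
(* At [s_ n = s] the quotient would be the default value 0; this excludes it for large [n]. *)
have ne0 : \forall n \near \oo, s_ n != s.
  near=> n; have : `|c 0%N| / 2 <= `|(s_ n - s) / w n| by near: n.
  apply: contraTneq => ->; rewrite subrr mul0r normr0 -ltNge divr_gt0 ?normr_gt0//.
split=> //.
(* The bound [M'] of the series over the lower bound [|c 0| / 2] of the ratio; adding 1 makes the
   constant positive. *)
apply/eqO_exP; exists (2 * M' / `|c 0%N| + 1).
    by rewrite ltr_pwDr// divr_ge0// mulr_ge0// (le_trans _ (hM' _ _ (lexx _) (cvS 0%N))).
near=> n.
have w0 : 0 < `|w n| by rewrite normr_gt0 (S1 n).1.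
have c1 : 0 < `|c 0%N| / 2 by rewrite divr_gt0 ?normr_gt0.
have q1 : `|c 0%N| / 2 <= `|(s_ n - s) / w n| by near: n.
have q0 := lt_le_trans c1 q1.
have n0 : (0 : R) < n%:R.
  by rewrite ltr0n; near: n; exact: nbhs_infty_gt.
have xn : 0 < n%:R ^+ (2 * k.+1) :> R by rewrite exprn_gt0.
have Px : n%:R ^+ (2 * k.+1) <= poch (beta + n%:R) (2 * k.+1).
  by rewrite exprn_le_poch ?ler0n// lerDr ltW.
have P0 := lt_le_trans xn Px.
have LM : `|limn (series (fun j => c (k.+1 + j)%N * poch j.+1%:R k.+1
    / poch (beta + n%:R + (2 * k.+1)%:R) j))| <= M'.
  apply: hM'; last by apply: cvgP; exact: cvS.
  by rewrite lerD2r lerD2l ler0n.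
have M0 : 0 <= M' by apply: le_trans LM.
(* Dividing through by [w n] separates the factor controlled by [bd] from the one controlled by
   [half]. *)
have -> : (wenigerS beta s_ w k.+1 n - s) / (s_ n - s) =
    (wenigerS beta s_ w k.+1 n - s) / w n / ((s_ n - s) / w n).
  by rewrite invfM invrK mulrACA mulVf ?mulr1// (S1 n).1.
rewrite normrM normfV ler_pdivrMr// normrM normfV ler_pdivrMr//.
apply: le_trans (bd n) _; rewrite !normrM !normfV.
rewrite (gtr0_norm P0) (gtr0_norm xn) [leRHS]mulrC -[leLHS]mulrA ler_wpM2l//.
apply: (@le_trans _ _ ((n%:R ^+ (2 * k.+1))^-1 * M')).
  by apply: ler_pM; rewrite ?invr_ge0 ?(ltW P0)// lef_pV2 ?posrE.
rewrite mulrAC mulrC ler_wpM2r ?invr_ge0 ?(ltW xn)//.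
rewrite [leLHS](_ : M' = (2 * M' / `|c 0%N|) * (`|c 0%N| / 2)); last first.
  by field; rewrite normr_eq0.
by rewrite ler_pM ?lerDl ?(ltW c1) ?divr_ge0 ?mulr_ge0// -normfV -normrM.
Unshelve. all: by end_near. Qed.
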